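(* Let ${\sf C}$ be a strict symmetric monoidal category and let $\mathbb{H}=(H_1,H_2)$ be a Hopf brace in ${\sf C}$. Let $(M,\varphi_{M}^{1},\varphi_{M}^{2})$ be an object of ${}_{\mathbb{H}}{\sf Mod}$, and let $\Gamma_{M}=\varphi_{M}^{1}\circ(\lambda_{H}^{1}\otimes\varphi_{M}^{2})\circ(\delta_{H}\otimes M)$. Then $(M,\varphi_{M}^{1},\varphi_{M}^{2})$ is an object of ${}_{\mathbb{H}}{\sf Mod}^{{\sf Z}}$ (i.e. a left ${\sf Z}$-module over $\mathbb{H}$) if and only if $(M,\Gamma_{M})$ belongs to the cocommutativity class of $H_{2}$.
   Context: ${\sf C}$ is a strict symmetric monoidal category with tensor product $\otimes$, unit object $K$ and symmetry $c$. For an object $P$ and a morphism $f$, write $P\otimes f$ for ${\rm id}_P\otimes f$ and $f\otimes P$ for $f\otimes {\rm id}_P$. Algebras, coalgebras, Hopf algebras, and modules over algebras in ${\sf C}$ are defined in the usual way; a Hopf algebra is written $(H,\eta_H,\mu_H,\varepsilon_H,\delta_H,\lambda_H)$ (unit, product, counit, coproduct, antipode). Hopf brace: a pair $\mathbb{H}=(H_1,H_2)$ of Hopf algebras $H_i=(H,\eta_H^i,\mu_H^i,\varepsilon_H,\delta_H,\lambda_H^i)$, $i=1,2$, in ${\sf C}$ with the same underlying coalgebra $(H,\varepsilon_H,\delta_H)$ (the two algebra structures are allowed to coincide) such that $$\mu_{H}^{2}\circ(H\otimes\mu_{H}^{1})=\mu_{H}^{1}\circ(\mu_{H}^{2}\otimes\Gamma_{H_{1}})\circ(H\otimes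 c_{H,H}\otimes H)\circ(\delta_{H}\otimes H\otimes H),$$ where $\Gamma_{H_{1}}= \mu_{H}^{1}\circ(\lambda_{H}^{1}\otimes\mu_{H}^{2})\circ(\delta_{H}\otimes H)$. It is known that then $\eta_H^1=\eta_H^2$. Left $\mathbb{H}$-module (object of ${}_{\mathbb{H}}{\sf Mod}$): a triple $(M,\varphi_{M}^{1},\varphi_{M}^{2})$ where $(M,\varphi_{M}^{1})$ is a left $H_{1}$-module, $(M,\varphi_{M}^{2})$ is a left $H_{2}$-module and $$\varphi_{M}^{2}\circ(H\otimes\varphi_{M}^{1})=\varphi_{M}^{1}\circ(\mu_{H}^{2}\otimes\Gamma_{M})\circ(H\otimes c_{H,H}\otimes M)\circ(\delta_{H}\otimes H\otimes M),$$ with $\Gamma_{M}=\varphi_{M}^{1}\circ(\lambda_{H}^{1}\otimes\varphi_{M}^{2})\circ(\delta_{H}\otimes M)$. It is known that $(M,\Gamma_M)$ is then a left $H_2$-module. Left ${\sf Z}$-module over $\mathbb{H}$ (object of ${}_{\mathbb{H}}{\sf Mod}^{{\sf Z}}$): a triple $(M,\varphi_{M}^{1},\varphi_{M}^{2})$ where $(M,\varphi_{M}^{1})$ is a left $H_{1}$-module, $(M,\varphi_{M}^{2})$ is a left $H_{2}$-module and, with $\Gamma_M$ given by the same formula, \begin{align*} &(\varphi_{M}^{2}\otimes H)\circ (H\otimes c_{H,M})\circ(\delta_{H}\otimes\varphi_{M}^{1})\\ =\,&(\varphi_{M}^{1}\otimes H)\circ(\mu_{H}^{2}\otimes((\Gamma_{M}\otimes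 H)\circ (H\otimes c_{H,M})\circ ((c_{H,H}\circ\delta_{H})\otimes M)))\circ(H\otimes c_{H,H}\otimes M)\circ (\delta_{H}\otimes H\otimes M). \end{align*} Cocommutativity class: a left $L$-module $(M,\varphi_M)$ over a Hopf algebra $L$ belongs to the cocommutativity class of $L$ if $$(\varphi_{M}\otimes L)\circ(L\otimes c_{L,M})\circ(\delta_{L}\otimes M)=(\varphi_{M}\otimes L)\circ(L\otimes c_{L,M})\circ((c_{L,L}\circ\delta_{L})\otimes M).$$ *)

(* Defs.v *)
From mathcomp Require Import ssreflect.

Set Implicit Arguments.
Unset Strict Implicit.
Unset Printing Implicit Defensive.

Declare Scope ob_scope.
Declare Scope hom_scope.
Delimit Scope ob_scope with ob.
Delimit Scope hom_scope with hom.

Reserved Notation "A ~> B" (at level 70, no associativity).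
Reserved Notation "A ⊗ B" (at level 35, right associativity).
Reserved Notation "g ∘ f" (at level 50, left associativity).
Reserved Notation "f ≡ g" (at level 70, no associativity).

(** * Strict symmetric monoidal categories *)

Record category := Category {
  obj :> Type;
  hom : obj -> obj -> Type;
  idm : forall A, hom A A;
  compm : forall A B D, hom B D -> hom A B -> hom A D;
  comp_idl : forall A B (f : hom A B), compm (idm B) f = f;
  comp_idr : forall A B (f : hom A B), compm f (idm A) = f;
  compA : forall A B D E (h : hom D E) (g : hom B D) (f : hom A B),
    compm h (compm g f) = compm (compm h g) f }.

Arguments hom {c} A%_ob B%_ob.
Arguments idm {c} A%_ob.
Notation "A ~> B" := (hom A%ob B%ob) : type_scope.

(* A morphism seen between equal objects. *)
Definition castm (C : category) (A A' B B' : C) (eA : A = A') (eB : B = B')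
    (f : A ~> B) : A' ~> B' :=
  match eA in _ = X, eB in _ = Y return X ~> Y with
  | eq_refl, eq_refl => f
  end.

(* Strictness is equality of objects; since that equality is not conversion,
   the corresponding equalities of morphisms are stated through castm. *)
Record strict_monoidal := StrictMonoidal {
  sm_cat :> category;
  munit : sm_cat;
  tens : sm_cat -> sm_cat -> sm_cat;
  tensm : forall A B A' B' : sm_cat,
    A ~> B -> A' ~> B' -> tens A A' ~> tens B B';
  tensA : forall A B D, tens (tens A B) D = tens A (tens B D);
  tens1l : forall A, tens munit A = A;
  tens1r : forall A, tens A munit = A;
  tensm_id : forall A B, tensm (idm A) (idm B) = idm (tens A B);
  tensm_comp : forall (A B D A' B' D' : sm_cat)
      (g : B ~> D) (f : A ~> B) (g' : B' ~> D') (f' : A' ~> B'),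
    tensm (compm g f) (compm g' f') = compm (tensm g g') (tensm f f');
  tensmA : forall (A1 B1 A2 B2 A3 B3 : sm_cat)
      (f : A1 ~> B1) (g : A2 ~> B2) (h : A3 ~> B3),
    castm (tensA A1 A2 A3) (tensA B1 B2 B3) (tensm (tensm f g) h)
      = tensm f (tensm g h);
  tensm1l : forall (A B : sm_cat) (f : A ~> B),
    castm (tens1l A) (tens1l B) (tensm (idm munit) f) = f;
  tensm1r : forall (A B : sm_cat) (f : A ~> B),
    castm (tens1r A) (tens1r B) (tensm f (idm munit)) = f }.

Arguments munit {s}.
Arguments tens {s} A%_ob B%_ob.
Arguments tensm {s A B A' B'} f%_hom g%_hom.

Notation "A ⊗ B" := (tens A B) : ob_scope.
Notation "f ⊗ g" := (tensm f g) : hom_scope.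

(* Proves that two bracketings of the same tensor word, up to units, are equal. *)
Ltac strict :=
  first [ exact: eq_refl | by rewrite ?(tens1l, tens1r, tensA) ].

(* Composition and equality of morphisms whose (co)domains agree in a strict
   monoidal category without being syntactically the same: the notations
   ∘ and ≡ find the equalities of objects automatically. By uniqueness of
   identity proofs, which equality is found is immaterial. *)
Definition scomp (C : category) (A B B' D : C) (g : B' ~> D) (f : A ~> B)
    (e : B = B') : A ~> D :=
  compm g (castm eq_refl e f).

Definition seqm (C : category) (A B A' B' : C) (f : A ~> B) (g : A' ~> B')
    (eA : A = A') (eB : B = B') : Prop :=
  castm eA eB f = g.

Notation "g ∘ f" := (scomp g%hom f%hom ltac:(strict)) (only parsing)
  : hom_scope.
Notation "f ≡ g" := (seqm f%hom g%hom ltac:(strict) ltac:(strict))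
  (only parsing) : type_scope.

Notation "g ∘ f" := (scomp g f _) (only printing) : hom_scope.
Notation "f ≡ g" := (seqm f g _ _) (only printing) : type_scope.

Open Scope hom_scope.

Record strict_symmetric_monoidal := StrictSymmetricMonoidal {
  ssm_mon :> strict_monoidal;
  sym : forall A B : ssm_mon, A ⊗ B ~> B ⊗ A;
  sym_natural : forall (A B A' B' : ssm_mon) (f : A ~> B) (g : A' ~> B'),
    sym B B' ∘ (f ⊗ g) = (g ⊗ f) ∘ sym A A';
  symK : forall A B : ssm_mon, sym B A ∘ sym A B = idm (A ⊗ B);
  sym_tensr : forall A B D : ssm_mon,
    sym A (B ⊗ D)%ob ≡ (idm B ⊗ sym A D) ∘ (sym A B ⊗ idm D);
  sym_tensl : forall A B D : ssm_mon,
    sym (A ⊗ B)%ob D ≡ (sym A D ⊗ idm B) ∘ (idm A ⊗ sym B D) }.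

Arguments sym {s} A%_ob B%_ob.

(** * Algebras, coalgebras, Hopf algebras and modules *)

Record algebra_on (C : strict_symmetric_monoidal) (A : C) := AlgebraOn {
  eta : munit ~> A;
  mu : A ⊗ A ~> A;
  mu_etal : mu ∘ (eta ⊗ idm A) ≡ idm A;
  mu_etar : mu ∘ (idm A ⊗ eta) ≡ idm A;
  muA : mu ∘ (mu ⊗ idm A) ≡ mu ∘ (idm A ⊗ mu) }.

Record coalgebra (C : strict_symmetric_monoidal) := Coalgebra {
  coalg_ob :> C;
  eps : coalg_ob ~> munit;
  delta : coalg_ob ~> coalg_ob ⊗ coalg_ob;
  delta_epsl : (eps ⊗ idm coalg_ob) ∘ delta ≡ idm coalg_ob;
  delta_epsr : (idm coalg_ob ⊗ eps) ∘ delta ≡ idm coalg_ob;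
  deltaA : (delta ⊗ idm coalg_ob) ∘ delta ≡ (idm coalg_ob ⊗ delta) ∘ delta }.

Arguments eps {C} c.
Arguments delta {C} c.

(* A Hopf algebra with underlying coalgebra H. *)
Record hopf_on (C : strict_symmetric_monoidal) (H : coalgebra C) := HopfOn {
  hopf_alg :> algebra_on H;
  lambda : H ~> H;
  eps_eta : eps H ∘ eta hopf_alg = idm munit;
  eps_mu : eps H ∘ mu hopf_alg ≡ eps H ⊗ eps H;
  delta_eta : delta H ∘ eta hopf_alg ≡ eta hopf_alg ⊗ eta hopf_alg;
  delta_mu : delta H ∘ mu hopf_alg =
    (mu hopf_alg ⊗ mu hopf_alg) ∘ (idm H ⊗ sym H H ⊗ idm H)
      ∘ (delta H ⊗ delta H);
  antipodel : mu hopf_alg ∘ (lambda ⊗ idm H) ∘ delta H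
    = eta hopf_alg ∘ eps H;
  antipoder : mu hopf_alg ∘ (idm H ⊗ lambda) ∘ delta H
    = eta hopf_alg ∘ eps H }.

Record is_module (C : strict_symmetric_monoidal) (A : C) (a : algebra_on A)
    (M : C) (phi : A ⊗ M ~> M) : Prop := IsModule {
  module_unit : phi ∘ (eta a ⊗ idm M) ≡ idm M;
  module_mul : phi ∘ (idm A ⊗ phi) ≡ phi ∘ (mu a ⊗ idm M) }.

Record cocommutativity_class (C : strict_symmetric_monoidal)
    (L : coalgebra C) (l : hopf_on L) (M : C) (phi : L ⊗ M ~> M) : Prop :=
  CocommutativityClass {
  cocomm_module : is_module l phi;
  cocomm_eq :
    (phi ⊗ idm L) ∘ (idm L ⊗ sym L M) ∘ (delta L ⊗ idm M)
    = (phi ⊗ idm L) ∘ (idm L ⊗ sym L M) ∘ ((sym L L ∘ delta L) ⊗ idm M) }.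

(** * Hopf braces, their modules and Z-modules *)

(* Gamma_M; for M = H and the two products as actions, this is Gamma_{H_1}. *)
Definition Gamma (C : strict_symmetric_monoidal) (H : coalgebra C)
    (h1 : hopf_on H) (M : C) (phi1 phi2 : H ⊗ M ~> M) : H ⊗ M ~> M :=
  phi1 ∘ (lambda h1 ⊗ phi2) ∘ (delta H ⊗ idm M).

Definition brace_compatible (C : strict_symmetric_monoidal) (H : coalgebra C)
    (h1 h2 : hopf_on H) : Prop :=
  mu h2 ∘ (idm H ⊗ mu h1) =
  mu h1 ∘ (mu h2 ⊗ Gamma h1 (mu h1) (mu h2))
    ∘ (idm H ⊗ sym H H ⊗ idm H) ∘ (delta H ⊗ idm H ⊗ idm H).

Record hopf_brace (C : strict_symmetric_monoidal) := HopfBrace {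
  brace_coalg :> coalgebra C;
  brace1 : hopf_on brace_coalg;
  brace2 : hopf_on brace_coalg;
  brace_eq : brace_compatible brace1 brace2 }.

Record is_brace_module (C : strict_symmetric_monoidal) (H : hopf_brace C)
    (M : C) (phi1 phi2 : H ⊗ M ~> M) : Prop := IsBraceModule {
  brace_module1 : is_module (brace1 H) phi1;
  brace_module2 : is_module (brace2 H) phi2;
  brace_module_eq :
    phi2 ∘ (idm H ⊗ phi1) =
    phi1 ∘ (mu (brace2 H) ⊗ Gamma (brace1 H) phi1 phi2)
      ∘ (idm H ⊗ sym H H ⊗ idm M) ∘ (delta H ⊗ idm H ⊗ idm M) }.

Record is_Z_module (C : strict_symmetric_monoidal) (H : hopf_brace C)
    (M : C) (phi1 phi2 : H ⊗ M ~> M) : Prop := IsZModule {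
  Z_module1 : is_module (brace1 H) phi1;
  Z_module2 : is_module (brace2 H) phi2;
  Z_module_eq :
    (phi2 ⊗ idm H) ∘ (idm H ⊗ sym H M) ∘ (delta H ⊗ phi1) =
    (phi1 ⊗ idm H)
      ∘ (mu (brace2 H) ⊗
           ((Gamma (brace1 H) phi1 phi2 ⊗ idm H) ∘ (idm H ⊗ sym H M)
              ∘ ((sym H H ∘ delta H) ⊗ idm M)))
      ∘ (idm H ⊗ sym H H ⊗ idm M) ∘ (delta H ⊗ idm H ⊗ idm M) }.

Arguments is_brace_module {C} H {M} phi1 phi2.
Arguments is_Z_module {C} H {M} phi1 phi2.

(* Main.v *)
(* In Sweedler notation write h.m, h∘m and Γ(h, m) for φ^1, φ^2 and Γ_M. By the
   module equation and coassociativity, the two sides of the Z-module equation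
   are (h_1∘g).V(h_2, m) and (h_1∘g).W(h_2, m), where V(h, m) = Γ(h_1, m) ⊗ h_2
   and W(h, m) = Γ(h_2, m) ⊗ h_1; the cocommutativity condition is V = W. For
   the converse put g = 1: the operation X ↦ h_1.X(h_2, m) is injective, with
   left inverse X ↦ λ(h_1).X(h_2, m). The same injectivity, over H ⊗ H, shows
   that Γ_M is an H_2-action. *)

From Stdlib Require Import ClassicalEpsilon.
From mathcomp Require Import all_boot.
Require Import Defs.

Set Implicit Arguments.
Unset Strict Implicit.
Unset Printing Implicit Defensive.

(** * Morphisms without object indices *)

(* Packing a morphism with its (co)domain turns the strictness laws into plain
   equalities, without castm. *)
Record arrow (C : category) := Arrow { dom : C; cod : C; mor : dom ~> cod }.
Arguments Arrow {C dom cod} mor.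
Coercion Arrow : hom >-> arrow.

Definition idarr (C : category) (A : C) : arrow C := idm A.
Coercion idarr : obj >-> arrow.

(* When the arrows are not composable, the value is f. *)
Definition comp (C : category) (g f : arrow C) : arrow C :=
  match excluded_middle_informative (cod f = dom g) with
  | left e => scomp (mor g) (mor f) e
  | right _ => f
  end.

Definition tensa (C : strict_monoidal) (f g : arrow C) : arrow C :=
  tensm (mor f) (mor g).

Declare Scope arrow_scope.
Delimit Scope arrow_scope with arr.
Bind Scope arrow_scope with arrow.
Notation "g ⊙ f" := (comp g%arr f%arr) (at level 50, left associativity).
Notation "f ⊠ g" := (tensa f%arr g%arr) (at level 35, right associativity).

Section Arrows.
Variable C : strict_monoidal.
Implicit Types (f g h : arrow C) (A B D : C).

Lemma Arrow_castm (A A' B B' : C) (eA : A = A') (eB : B = B') (f : A ~> B) :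
  Arrow (castm eA eB f) = f.
Proof. by case: _ / eA; case: _ / eB. Qed.

(** The way back from packed arrows to typed morphisms: once [y] is replaced by [x], proof
    irrelevance turns both equalities of objects into [erefl]. *)
Lemma Arrow_eq (x y : arrow C) (eA : dom x = dom y) (eB : cod x = cod y) :
  x = y -> castm eA eB (mor x) = mor y.
Proof.
move=> exy; case: _ / exy eA eB => eA eB.
by rewrite (proof_irrelevance _ eA erefl) (proof_irrelevance _ eB erefl).
Qed.

Lemma Arrow_inj (A B : C) (f g : A ~> B) : Arrow f = Arrow g -> f = g.
Proof. exact: (@Arrow_eq (Arrow f) (Arrow g) erefl erefl). Qed.

Lemma seqmP (A B A' B' : C) (f : A ~> B) (g : A' ~> B') eA eB :
  seqm f g eA eB <-> Arrow f = Arrow g.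
Proof.
split=> [<-|]; first by rewrite Arrow_castm.
exact: (@Arrow_eq (Arrow f) (Arrow g)).
Qed.

Lemma Arrow_scomp (A B B' D : C) (g : B' ~> D) (f : A ~> B) (e : B = B') :
  Arrow (scomp g f e) = g ⊙ f.
Proof.
rewrite /comp /=; case: excluded_middle_informative => // e'.
by rewrite (proof_irrelevance _ e e').
Qed.

Lemma Arrow_tensm (A B A' B' : C) (f : A ~> B) (g : A' ~> B') :
  Arrow (tensm f g) = f ⊠ g.
Proof. by []. Qed.

Lemma Arrow_idm A : Arrow (idm A) = A.
Proof. by []. Qed.

Lemma dom_comp g f : dom (g ⊙ f) = dom f.
Proof. by rewrite /comp; case: excluded_middle_informative. Qed.

Lemma cod_comp g f : cod f = dom g -> cod (g ⊙ f) = cod g.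
Proof. by rewrite /comp; case: excluded_middle_informative. Qed.

Lemma compE (A B D : C) (g : B ~> D) (f : A ~> B) : g ⊙ f = compm g f :> arrow C.
Proof. by rewrite -(Arrow_scomp g f erefl). Qed.

Lemma comp_assoc h g f : cod f = dom g -> cod g = dom h ->
  h ⊙ (g ⊙ f) = h ⊙ g ⊙ f.
Proof.
case: f g h => [A B f] [B' D g] [D' E h] /= e e'; subst.
by rewrite !compE compA.
Qed.

Lemma comp_id_l A f : cod f = A -> A ⊙ f = f.
Proof. by case: f => [A' B' f] /= e; subst; rewrite compE comp_idl. Qed.

Lemma comp_id_r A f : dom f = A -> f ⊙ A = f.
Proof. by case: f => [A' B' f] /= e; subst; rewrite compE comp_idr. Qed.

Lemma tensa_id A B : A ⊠ B = (A ⊗ B)%ob :> arrow C.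
Proof. by rewrite /tensa /= tensm_id. Qed.

Lemma tensaA f g h : (f ⊠ g) ⊠ h = f ⊠ g ⊠ h.
Proof.
by rewrite /tensa /= -tensmA Arrow_castm.
Qed.

Lemma tensa1l f : (munit : C) ⊠ f = f.
Proof. by case: f => A B f; rewrite -[in RHS](tensm1l f) Arrow_castm. Qed.

Lemma tensa1r f : f ⊠ (munit : C) = f.
Proof. by case: f => A B f; rewrite -[in RHS](tensm1r f) Arrow_castm. Qed.

Lemma interchange g f g' f' : cod f = dom g -> cod f' = dom g' ->
  (g ⊙ f) ⊠ (g' ⊙ f') = (g ⊠ g') ⊙ (f ⊠ f').
Proof.
case: f g f' g' => [A B f] [B' D g] [A1 B1 f'] [B1' D1 g'] /= e e'; subst.
by rewrite !compE /tensa /= tensm_comp.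
Qed.

(** * Equality up to interchange *)

(* Objects are words [seq C]; a morphism is a list of slices, each of which
   applies one box with identities on both sides. *)
Fixpoint word (w : seq C) : C := if w is A :: w' then (A ⊗ word w')%ob else munit.

Lemma word_cat u v : word (u ++ v) = (word u ⊗ word v)%ob.
Proof. by elim: u => [|A u IH] /=; rewrite ?tens1l // IH tensA. Qed.

Lemma idarr_cat u v : word (u ++ v) = word u ⊠ word v :> arrow C.
Proof. by rewrite word_cat tensa_id. Qed.

Record slice := Slice {
  sleft : seq C; sdom : seq C; sarr : arrow C; scod : seq C; sright : seq C }.

Definition slice_eval (s : slice) := word (sleft s) ⊠ sarr s ⊠ word (sright s).

Fixpoint eval (u : seq C) (l : seq slice) : arrow C :=
  if l is s :: l' then
    eval (sleft s ++ scod s ++ sright s) l' ⊙ slice_eval s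
  else word u.

(** Well-typedness of a list of slices, which keeps [eval] away from the default value of [comp]. *)
Fixpoint chain (u : seq C) (l : seq slice) (v : seq C) : Prop :=
  if l is s :: l' then
    [/\ u = sleft s ++ sdom s ++ sright s,
        dom (sarr s) = word (sdom s), cod (sarr s) = word (scod s) &
        chain (sleft s ++ scod s ++ sright s) l' v]
  else u = v.

Lemma dom_eval u l v : chain u l v -> dom (eval u l) = word u.
Proof.
case: l => [|[a x f y b] l] //= [-> d _ _].
by rewrite dom_comp /= d !word_cat.
Qed.

Lemma cod_slice_eval a x f y b : cod f = word y ->
  cod (slice_eval (Slice a x f y b)) = word (a ++ y ++ b).
Proof. by move=> /= ->; rewrite !word_cat. Qed.

Lemma dom_slice_eval a x f y b : dom f = word x ->
  dom (slice_eval (Slice a x f y b)) = word (a ++ x ++ b).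
Proof. by move=> /= ->; rewrite !word_cat. Qed.

Lemma cod_eval u l v : chain u l v -> cod (eval u l) = word v.
Proof.
elim: l u => [|[a x f y b] l IH] u /=; first by move->.
case=> _ d c ch; rewrite cod_comp; first exact: IH ch.
by rewrite cod_slice_eval // (dom_eval ch).
Qed.

Lemma eval_cat u l v l' w : chain u l v -> chain v l' w ->
  eval u (l ++ l') = eval v l' ⊙ eval u l.
Proof.
elim: l u => [|[a x f y b] l IH] u /=.
  by move=> -> ch; rewrite comp_id_r ?(dom_eval ch).
case=> _ d c ch ch'; rewrite (IH _ ch ch') comp_assoc //.
  by rewrite cod_slice_eval // (dom_eval ch).
by rewrite (cod_eval ch) (dom_eval ch').
Qed.

Lemma chain_cat u l v l' w : chain u l v -> chain v l' w -> chain u (l ++ l') w.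
Proof.
by elim: l u => [|s l IH] u /=; [move-> | case=> ? ? ? ch ch'; split; auto].
Qed.

Definition whisker a b (s : slice) :=
  Slice (a ++ sleft s) (sdom s) (sarr s) (scod s) (sright s ++ b).

Lemma chain_whisker a b u l v :
  chain u l v -> chain (a ++ u ++ b) (map (whisker a b) l) (a ++ v ++ b).
Proof.
elim: l u => [|[c x f y d] l IH] u /=; first by move->.
case=> -> ? ? /IH; rewrite -!catA; by split.
Qed.

Lemma eval_whisker a b u l v : chain u l v ->
  eval (a ++ u ++ b) (map (whisker a b) l) = word a ⊠ eval u l ⊠ word b.
Proof.
elim: l u => [|[c x f y d] l IH] u /=; first by rewrite !idarr_cat.
case=> _ hd hc ch; move: (IH _ ch); rewrite -!catA => ->.
rewrite -{2}[word a : arrow C](@comp_id_l (word a)) //.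
rewrite -{2}[word b : arrow C](@comp_id_l (word b)) //.
have e : cod (slice_eval (Slice c x f y d))
         = dom (eval (c ++ y ++ d) l) by rewrite cod_slice_eval // (dom_eval ch).
rewrite !interchange //=; last by rewrite -e.
by rewrite /slice_eval /= !idarr_cat !tensaA.
Qed.

Definition planar (f : arrow C) u v l := chain u l v /\ f = eval u l.

Lemma planar_arrow u v A B (f : A ~> B) : A = word u -> B = word v ->
  planar f u v [:: Slice [::] u f v [::]].
Proof.
move=> eA eB; split; first by rewrite /= !cats0.
by rewrite /= /slice_eval /= tensa1l tensa1r comp_id_l //= cats0.
Qed.

Lemma planar_id u A : A = word u -> planar A u u [::].
Proof. by move=> ->; split. Qed.

Lemma planar_comp g f u v v' w l l' : planar f u v l -> planar g v' w l' ->
  v = v' -> planar (g ⊙ f) u w (l ++ l').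
Proof.
case=> ch -> [ch' ->] e; subst v'; split; first exact: chain_cat ch ch'.
by rewrite (eval_cat ch ch').
Qed.

(** By interchange f ⊗ g = (id ⊗ g) ∘ (f ⊗ id): the boxes of [f] come first, then those of [g],
    placed to the right of the output word [v]. *)
Lemma planar_tensa f g u v u' v' l l' : planar f u v l -> planar g u' v' l' ->
  planar (f ⊠ g) (u ++ u') (v ++ v')
    (map (whisker [::] u') l ++ map (whisker v [::]) l').
Proof.
case=> ch -> [ch' ->].
have c1 := chain_whisker [::] u' ch; have c2 := chain_whisker v [::] ch'.
have := eval_whisker [::] u' ch; have := eval_whisker v [::] ch'.
move: c1 c2; rewrite /= !cats0 tensa1r tensa1l => c1 c2 e2 e1.
split; first exact: chain_cat c1 c2.
rewrite (eval_cat c1 c2) e1 e2 -interchange /= ?(cod_eval ch) ?(dom_eval ch') //.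
by rewrite comp_id_l ?comp_id_r ?(cod_eval ch) ?(dom_eval ch').
Qed.

(* A box is pulled ahead of the preceding one when its inputs lie entirely to
   the left of that one. *)
Fixpoint insert (s : slice) (l : seq slice) : seq slice :=
  if l is s' :: l' then
    let n := size (sleft s') + size (sdom s') in
    if n <= size (sleft s) then
      let w := drop n (sleft s) in
      Slice (sleft s') (sdom s') (sarr s') (scod s') (w ++ sdom s ++ sright s)
      :: insert (Slice (sleft s' ++ scod s' ++ w) (sdom s) (sarr s) (scod s)
                   (sright s)) l'
    else s :: l
  else [:: s].

Definition normalize (l : seq slice) := foldr insert [::] l.

Lemma slide a x f y w x' g y' b :
    dom f = word x -> cod f = word y -> dom g = word x' -> cod g = word y' ->
  slice_eval (Slice a x f y (w ++ y' ++ b)) ⊙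
    slice_eval (Slice (a ++ x ++ w) x' g y' b)
  = slice_eval (Slice (a ++ y ++ w) x' g y' b) ⊙
    slice_eval (Slice a x f y (w ++ x' ++ b)).
Proof.
move=> df cf dg cg; rewrite /slice_eval /= !idarr_cat !tensaA.
by rewrite -!interchange //= ?(df, cf, dg, cg) //;
  rewrite !comp_id_l ?comp_id_r.
Qed.

Lemma cat_overlap (T : Type) (p q r t : seq T) : p ++ q = r ++ t ->
  size r <= size p -> p = r ++ drop (size r) p /\ t = drop (size r) p ++ q.
Proof.
move=> e le; have er : r = take (size r) p.
  by rewrite -(takel_cat q le) e take_size_cat.
have ep : p = r ++ drop (size r) p by rewrite {1}er cat_take_drop.
split=> //.
by rewrite -(drop_size_cat t (erefl (size r))) -e {1}ep -catA drop_size_cat.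
Qed.

Lemma insertP s u l v : chain u (s :: l) v ->
  chain u (insert s l) v /\ eval u (insert s l) = eval u (s :: l).
Proof.
elim: l s u => [|[a x f y b] l IH] [a' x' f' y' b'] u //.
case=> /= eu d' c' [] e d c ch; case: ifP => // le.
set w := drop _ a'.
(* The word between the two boxes is split in two ways; the size test makes [a ++ x] a prefix of
   [a'], and [w] is the word of wires separating the boxes. *)
have [ea eb] : a' = a ++ x ++ w /\ b = w ++ y' ++ b'.
  move: e; rewrite [in RHS]catA => /cat_overlap.
  by rewrite size_cat -/w -catA; apply.
have ch2 : chain (a ++ y ++ w ++ x' ++ b')
    (Slice (a ++ y ++ w) x' f' y' b' :: l) v.
  by split; rewrite /= -?catA // -eb.
have [ch3 e3] := IH _ _ ch2; split.
  by split=> //; rewrite eu ea -!catA.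
rewrite [LHS]/= {}e3 /= -!catA -eb -!comp_assoc.
- by rewrite ea eb -slide.
- by rewrite cod_slice_eval // dom_slice_eval // ea eb -!catA.
- by rewrite cod_slice_eval // (dom_eval ch).
- by rewrite cod_slice_eval // dom_slice_eval // -!catA.
- by rewrite cod_slice_eval // -!catA -eb (dom_eval ch).
Qed.

Lemma normalizeP u l v : chain u l v ->
  chain u (normalize l) v /\ eval u (normalize l) = eval u l.
Proof.
elim: l u => [|s l IH] u //=; case=> ? ? ? /IH [ch e].
have [|ch' ->] := @insertP s u (normalize l) v; first by split.
by rewrite /= e.
Qed.

(** The reflection principle: [normalize] preserves values, so an equality of arrows reduces to
    comparing two computed lists. *)
Lemma planar_eq f g u v l u' v' l' : planar f u v l -> planar g u' v' l' ->
  u = u' -> normalize l = normalize l' -> f = g.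
Proof.
move=> [ch ->] [ch' ->] eu e; rewrite -(normalizeP ch).2 -(normalizeP ch').2.
by rewrite e eu.
Qed.

End Arrows.

(** * Reification of arrows as lists of slices *)

Ltac ob_word A :=
  lazymatch A with
  | tens ?B ?D => let u := ob_word B in let v := ob_word D in
                  eval cbn in (u ++ v)
  | @munit ?C => constr:(@nil (obj (sm_cat C)))
  | _ => constr:([:: A])
  end.

Ltac ob_strict := cbn; rewrite ?(tens1l, tens1r, tensA); exact: erefl.

Ltac reify_planar :=
  lazymatch goal with
  | |- planar (_ ⊙ _) _ _ _ =>
      eapply planar_comp; [reify_planar | reify_planar | reflexivity]
  | |- planar (_ ⊠ _) _ _ _ => eapply planar_tensa; reify_planar
  | |- planar (idarr ?A) _ _ _ =>
      let u := ob_word A in eapply (@planar_id _ u A); ob_strict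
  | |- planar (Arrow (idm ?A)) _ _ _ =>
      change (Arrow (idm A)) with (idarr A); reify_planar
  | |- planar (@Arrow _ ?A ?B ?f) _ _ _ =>
      let u := ob_word A in let v := ob_word B in
      eapply (@planar_arrow _ u v A B f); ob_strict
  end.

(* Proves equalities that hold in every strict monoidal category. Symmetries are
   boxes like any other, so their laws have to be rewritten explicitly. *)
Ltac planar :=
  eapply planar_eq; [reify_planar | reify_planar | reflexivity | reflexivity].

Lemma planar_dom (C : strict_monoidal) (f : arrow C) u v l A :
  planar f u v l -> word u = A -> dom f = A.
Proof. by case=> ch -> <-; exact: dom_eval ch. Qed.

Lemma planar_cod (C : strict_monoidal) (f : arrow C) u v l A :
  planar f u v l -> word v = A -> cod f = A.
Proof. by case=> ch -> <-; exact: cod_eval ch. Qed.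

Ltac typing :=
  lazymatch goal with
  | |- dom _ = _ => eapply planar_dom; [reify_planar | ob_strict]
  | |- cod _ = _ => eapply planar_cod; [reify_planar | ob_strict]
  end.

Definition arrowE := (Arrow_scomp, Arrow_tensm, Arrow_idm).

(** * Hopf algebras and their modules *)

Section Symmetry.
Variable C : strict_symmetric_monoidal.
Implicit Types A B D : C.

Lemma sym_nat A B A' B' (f : A ~> B) (g : A' ~> B') :
  sym B B' ⊙ (f ⊠ g) = (g ⊠ f) ⊙ sym A A'.
Proof. by have /(congr1 (@Arrow C _ _)) := sym_natural f g; rewrite !arrowE. Qed.

Lemma sym_tens_r A B D :
  sym A (B ⊗ D)%ob = (B ⊠ sym A D) ⊙ (sym A B ⊠ D) :> arrow C.
Proof. by have /seqmP := sym_tensr A B D; rewrite !arrowE. Qed.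

Lemma sym_tens_l A B D :
  sym (A ⊗ B)%ob D = (sym A D ⊠ B) ⊙ (A ⊠ sym B D) :> arrow C.
Proof. by have /seqmP := sym_tensl A B D; rewrite !arrowE. Qed.

Lemma sym_invol A B : sym B A ⊙ sym A B = A ⊠ B.
Proof.
by have /(congr1 (@Arrow C _ _)) := symK A B; rewrite !arrowE tensa_id.
Qed.

(** Since K ⊗ K = K, the hexagon law makes c_{A,K} idempotent; being invertible, it is the
    identity. *)
Lemma sym_unit_r A : sym A munit = A :> arrow C.
Proof.
have idem : sym A munit = sym A munit ⊙ sym A munit :> arrow C.
  have eu X : X = munit -> sym A X = sym A munit :> arrow C by move->.
  by rewrite -{1}(eu _ (tens1l munit)) sym_tens_r; planar.
transitivity (sym munit A ⊙ sym A munit ⊙ sym A munit).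
  by rewrite sym_invol; planar.
transitivity (sym munit A ⊙ (sym A munit ⊙ sym A munit)); first planar.
by rewrite -idem sym_invol; planar.
Qed.

End Symmetry.

(** * Coproducts, antipodes and convolution *)

Section HopfModule.
Variables (C : strict_symmetric_monoidal) (H : coalgebra C).
Notation δ := (delta H).
Notation ε := (eps H).

Lemma delta_coassoc : (δ ⊠ H) ⊙ δ = (H ⊠ δ) ⊙ δ.
Proof. by have /seqmP := deltaA H; rewrite !arrowE. Qed.

Lemma delta_counit_l : (ε ⊠ H) ⊙ δ = H.
Proof. by have /seqmP := delta_epsl H; rewrite !arrowE. Qed.

(* The coproduct of H ⊗ H. *)
Definition delta2 : arrow C := (H ⊠ sym H H ⊠ H) ⊙ (δ ⊠ δ).

Lemma delta_sym_l :
  (δ ⊠ H) ⊙ sym H H = (H ⊠ sym H H) ⊙ (sym H H ⊠ H) ⊙ (H ⊠ δ).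
Proof. by rewrite -sym_nat sym_tens_r. Qed.

Lemma delta_sym_r :
  (H ⊠ δ) ⊙ sym H H = (sym H H ⊠ H) ⊙ (H ⊠ sym H H) ⊙ (δ ⊠ H).
Proof. by rewrite -sym_nat sym_tens_l. Qed.

(** Naturality slides δ through the symmetry, after which coassociativity of δ applies in each of
    the two factors. *)
Lemma delta2_coassoc : (delta2 ⊠ H ⊠ H) ⊙ delta2 = (H ⊠ H ⊠ delta2) ⊙ delta2.
Proof.
rewrite /delta2.
transitivity ((H ⊠ sym H H ⊠ H ⊠ H ⊠ H) ⊙
  (H ⊠ H ⊠ ((δ ⊠ H) ⊙ sym H H) ⊠ H) ⊙ (((δ ⊠ H) ⊙ δ) ⊠ δ)); first planar.
rewrite delta_sym_l delta_coassoc.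
transitivity ((H ⊠ H ⊠ H ⊠ sym H H ⊠ H) ⊙ (H ⊠ sym H H ⊠ H ⊠ H ⊠ H) ⊙
  (H ⊠ H ⊠ sym H H ⊠ H ⊠ H) ⊙ (((H ⊠ δ) ⊙ δ) ⊠ ((δ ⊠ H) ⊙ δ))); first planar.
rewrite [in (δ ⊠ H) ⊙ δ]delta_coassoc.
transitivity ((H ⊠ H ⊠ H ⊠ sym H H ⊠ H) ⊙
  (H ⊠ ((H ⊠ δ) ⊙ sym H H) ⊠ H ⊠ H) ⊙ (δ ⊠ ((H ⊠ δ) ⊙ δ))).
  by rewrite delta_sym_r; planar.
planar.
Qed.

Lemma delta2_counit : ((ε ⊠ ε) ⊠ H ⊠ H) ⊙ delta2 = H ⊠ H.
Proof.
have eps_sym : (ε ⊠ H) ⊙ sym H H = H ⊠ ε.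
  by rewrite -sym_nat sym_unit_r; planar.
rewrite /delta2.
transitivity ((ε ⊠ ((ε ⊠ H) ⊙ sym H H) ⊠ H) ⊙ (δ ⊠ δ)); first planar.
rewrite eps_sym.
transitivity (((ε ⊠ H) ⊙ δ) ⊠ ((ε ⊠ H) ⊙ δ)); first planar.
by rewrite delta_counit_l.
Qed.

Variable h : hopf_on H.

Lemma delta_mul : δ ⊙ mu h = (mu h ⊠ mu h) ⊙ delta2.
Proof.
have /(congr1 (@Arrow C _ _)) := delta_mu h; rewrite !arrowE => ->.
by rewrite /delta2; planar.
Qed.

Lemma eps_mul : ε ⊙ mu h = ε ⊠ ε.
Proof. by have /seqmP := eps_mu h; rewrite !arrowE. Qed.

Lemma delta_unit : δ ⊙ eta h = eta h ⊠ eta h.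
Proof. by have /seqmP := delta_eta h; rewrite !arrowE. Qed.

Lemma mul_unit_l : mu h ⊙ (eta h ⊠ H) = H.
Proof. by have /seqmP := mu_etal h; rewrite !arrowE. Qed.

Lemma mul_unit_r : mu h ⊙ (H ⊠ eta h) = H.
Proof. by have /seqmP := mu_etar h; rewrite !arrowE. Qed.

Lemma antipode_l : mu h ⊙ (lambda h ⊠ H) ⊙ δ = eta h ⊙ ε.
Proof. by have /(congr1 (@Arrow C _ _)) := antipodel h; rewrite !arrowE. Qed.

Lemma antipode_r : mu h ⊙ (H ⊠ lambda h) ⊙ δ = eta h ⊙ ε.
Proof. by have /(congr1 (@Arrow C _ _)) := antipoder h; rewrite !arrowE. Qed.

Variables (M : C) (phi : H ⊗ M ~> M).
Hypothesis phiP : is_module h phi.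

Lemma act_unit : phi ⊙ (eta h ⊠ M) = M.
Proof. by have /seqmP := module_unit phiP; rewrite !arrowE. Qed.

Lemma act_mul : phi ⊙ (H ⊠ phi) = phi ⊙ (mu h ⊠ M).
Proof. by have /seqmP := module_mul phiP; rewrite !arrowE. Qed.

(* In Sweedler notation: a(x_1).(b(x_2).X(x_3)) = X(x) as soon as
   a(x_1) b(x_2) = e(x) 1. *)
Lemma convolution_cancel (D N K : C) (d e a b X : arrow C) :
    dom d = D -> cod d = (D ⊗ D)%ob -> dom e = D -> cod e = munit ->
    dom a = D -> cod a = H -> dom b = D -> cod b = H ->
    dom X = (D ⊗ N)%ob -> cod X = (M ⊗ K)%ob ->
    (d ⊠ D) ⊙ d = (D ⊠ d) ⊙ d -> (e ⊠ D) ⊙ d = D ->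
    mu h ⊙ (a ⊠ b) ⊙ d = eta h ⊙ e ->
  (phi ⊠ K) ⊙ (a ⊠ ((phi ⊠ K) ⊙ (b ⊠ X) ⊙ (d ⊠ N))) ⊙ (d ⊠ N) = X.
Proof.
case: d e a b X => [D1 D2 d] [D3 D4 e] [D5 D6 a] [D7 D8 b] [D9 D10 X] /=.
do 10!move=> ?; subst => d_coassoc d_counit ab.
transitivity (((phi ⊙ (H ⊠ phi)) ⊠ K) ⊙ (a ⊠ b ⊠ X) ⊙
  (((D ⊠ d) ⊙ d) ⊠ N)); first planar.
rewrite -d_coassoc act_mul.
transitivity ((phi ⊠ K) ⊙ ((mu h ⊙ (a ⊠ b) ⊙ d) ⊠ X) ⊙ (d ⊠ N)); first planar.
rewrite ab.
transitivity (((phi ⊙ (eta h ⊠ M)) ⊠ K) ⊙ X ⊙ (((e ⊠ D) ⊙ d) ⊠ N)); first planar.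
by rewrite act_unit d_counit; planar.
Qed.

(** As [p] respects coproducts and counits, [lambda h ⊙ p] is a left convolution inverse of it;
    [convolution_cancel] then inverts X ↦ p(x_1).X(x_2) on the left. *)
Lemma convolution_inj (D N K : C) (d e p X Y : arrow C) :
    dom d = D -> cod d = (D ⊗ D)%ob -> dom e = D -> cod e = munit ->
    dom p = D -> cod p = H ->
    dom X = (D ⊗ N)%ob -> cod X = (M ⊗ K)%ob ->
    dom Y = (D ⊗ N)%ob -> cod Y = (M ⊗ K)%ob ->
    (d ⊠ D) ⊙ d = (D ⊠ d) ⊙ d -> (e ⊠ D) ⊙ d = D ->
    δ ⊙ p = (p ⊠ p) ⊙ d -> ε ⊙ p = e ->
    (phi ⊠ K) ⊙ (p ⊠ X) ⊙ (d ⊠ N) = (phi ⊠ K) ⊙ (p ⊠ Y) ⊙ (d ⊠ N) ->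
  X = Y.
Proof.
move=> dd cd de ce dp cp dX cX dY cY d_coassoc d_counit dmul emul eXY.
have lp : mu h ⊙ ((lambda h ⊙ p) ⊠ p) ⊙ d = eta h ⊙ e.
  case: d e p dd cd de ce dp cp {eXY d_coassoc d_counit} dmul emul
    => [D1 D2 d] [D3 D4 e] [D5 D6 p] /= ? ? ? ? ? ?; subst => dmul emul.
  transitivity (mu h ⊙ (lambda h ⊠ H) ⊙ ((p ⊠ p) ⊙ d)); first planar.
  rewrite -dmul -emul.
  transitivity ((mu h ⊙ (lambda h ⊠ H) ⊙ δ) ⊙ p); first planar.
  by rewrite antipode_l; planar.
have dlp : dom (lambda h ⊙ p) = D by rewrite dom_comp.
have clp : cod (lambda h ⊙ p) = H by rewrite cod_comp.
rewrite -(@convolution_cancel D N K d e _ p X _ _ _ _ dlp clp) // eXY.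
by rewrite (@convolution_cancel D N K d e _ p Y).
Qed.

End HopfModule.

(** * Modules over a Hopf brace *)

Section BraceModule.
Variables (C : strict_symmetric_monoidal) (H : hopf_brace C) (M : C).
Variables phi1 phi2 : H ⊗ M ~> M.
Hypothesis phiP : is_brace_module H phi1 phi2.
Notation δ := (delta H).
Notation ε := (eps H).
Notation μ := (mu (brace2 H)).
Notation η := (eta (brace2 H)).
Notation c := (sym H H).
Notation cM := (sym H M).
Notation Γ := (Gamma (brace1 H) phi1 phi2).

Let phi1P := brace_module1 phiP.
Let phi2P := brace_module2 phiP.

Lemma GammaE : Γ = phi1 ⊙ (lambda (brace1 H) ⊠ phi2) ⊙ (δ ⊠ M) :> arrow C.
Proof. by rewrite /Gamma !arrowE. Qed.

Lemma brace_act : phi2 ⊙ (H ⊠ phi1) =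
  phi1 ⊙ (μ ⊠ Γ) ⊙ (H ⊠ c ⊠ M) ⊙ (δ ⊠ H ⊠ M).
Proof.
by have /(congr1 (@Arrow C _ _)) := brace_module_eq phiP; rewrite !arrowE.
Qed.

(** Cancellation of the antipode: h_1.(λ(h_2).(h_3∘m)) = h∘m, because h_1 λ(h_2) = ε(h) 1 in H_1. *)
Lemma act1_Gamma : phi1 ⊙ (H ⊠ Γ) ⊙ (δ ⊠ M) = phi2.
Proof.
rewrite GammaE.
(* The unit object fills the place of the spectator [K] in [convolution_cancel]. *)
transitivity ((phi1 ⊠ (munit : C)) ⊙ (H ⊠ ((phi1 ⊠ (munit : C)) ⊙
  (lambda (brace1 H) ⊠ phi2) ⊙ (δ ⊠ M))) ⊙ (δ ⊠ M)); first planar.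
apply: (convolution_cancel phi1P (e := ε)) => //; try typing.
- exact: delta_coassoc.
- exact: delta_counit_l.
- exact: antipode_r.
Qed.

(** The module equation is evaluated at the unit 1 of H_2 and the unit g of H_1: its left side is
    1∘(g.m) = m, its right side (1∘g).Γ(1, m) = g.Γ(1, m) = Γ(1, m). *)
Lemma Gamma_unit : Γ ⊙ (η ⊠ M) = M.
Proof.
have e : phi2 ⊙ (H ⊠ phi1) ⊙ (η ⊠ eta (brace1 H) ⊠ M) = M.
  transitivity (phi2 ⊙ (η ⊠ (phi1 ⊙ (eta (brace1 H) ⊠ M)))); first planar.
  by rewrite (act_unit phi1P) (act_unit phi2P).
rewrite -[RHS]e brace_act.
have sym_eta : c ⊙ (η ⊠ eta (brace1 H)) = eta (brace1 H) ⊠ η.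
  by rewrite sym_nat sym_unit_r; planar.
transitivity (phi1 ⊙ (μ ⊠ Γ) ⊙ (H ⊠ c ⊠ M) ⊙
  ((δ ⊙ η) ⊠ eta (brace1 H) ⊠ M)); last planar.
rewrite delta_unit.
transitivity (phi1 ⊙ (μ ⊠ Γ) ⊙
  (η ⊠ (c ⊙ (η ⊠ eta (brace1 H))) ⊠ M)); last planar.
rewrite sym_eta.
transitivity (phi1 ⊙ ((μ ⊙ (η ⊠ H)) ⊠ M) ⊙
  (eta (brace1 H) ⊠ (Γ ⊙ (η ⊠ M)))); last planar.
rewrite mul_unit_l.
transitivity (phi1 ⊙ (eta (brace1 H) ⊠ M) ⊙ Γ ⊙ (η ⊠ M)); last planar.
by rewrite (act_unit phi1P); planar.
Qed.

(* Both sides, with argument h ⊗ g ⊗ m, have the same image h∘(g∘m) under the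
   injective operation X ↦ (h_1∘g_1).X(h_2, g_2, m). *)
Lemma Gamma_mul : Γ ⊙ (H ⊠ Γ) = Γ ⊙ (μ ⊠ M).
Proof.
apply: (convolution_inj phi1P (D := (H ⊗ H)%ob) (N := M) (K := munit)
  (d := delta2 H) (e := ε ⊠ ε) (p := μ)); rewrite /delta2 //; try typing.
- transitivity ((delta2 H ⊠ H ⊠ H) ⊙ delta2 H); first by rewrite /delta2; planar.
  by rewrite delta2_coassoc /delta2; planar.
- transitivity (((ε ⊠ ε) ⊠ H ⊠ H) ⊙ delta2 H); first by rewrite /delta2; planar.
  by rewrite delta2_counit tensa_id.
- exact: delta_mul.
- exact: eps_mul.
transitivity (phi1 ⊙ (μ ⊠ Γ) ⊙ (H ⊠ c ⊠ M) ⊙ (δ ⊠ H ⊠ M) ⊙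
  (H ⊠ ((H ⊠ Γ) ⊙ (δ ⊠ M)))); first planar.
rewrite -brace_act.
transitivity (phi2 ⊙ (H ⊠ (phi1 ⊙ (H ⊠ Γ) ⊙ (δ ⊠ M)))); first planar.
rewrite act1_Gamma (act_mul phi2P) -{1}act1_Gamma.
transitivity (phi1 ⊙ (H ⊠ Γ) ⊙ ((δ ⊙ μ) ⊠ M)); first planar.
by rewrite delta_mul /delta2; planar.
Qed.

Lemma Gamma_module : is_module (brace2 H) Γ.
Proof.
split; apply/seqmP; rewrite !arrowE -GammaE.
- exact: Gamma_unit.
- exact: Gamma_mul.
Qed.

(** * The Z-module equation as [twist V] = [twist W] *)

Notation V := ((Γ ⊠ H) ⊙ (H ⊠ cM) ⊙ (δ ⊠ M)).
Notation W := ((Γ ⊠ H) ⊙ (H ⊠ cM) ⊙ ((c ⊙ δ) ⊠ M)).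
Notation twist X := ((phi1 ⊠ H) ⊙ (μ ⊠ X) ⊙ (H ⊠ c ⊠ M) ⊙ (δ ⊠ H ⊠ M)).

(** In Sweedler notation h_1∘(g.m) ⊗ h_2 = (h_1∘g).Γ(h_2, m) ⊗ h_3, where h_2 and h_3 are the two
    parts of one coproduct, as in V. *)
Lemma Z_module_lhs : (phi2 ⊠ H) ⊙ (H ⊠ cM) ⊙ (δ ⊠ phi1) = twist V.
Proof.
have sym_phi1 : cM ⊙ (H ⊠ phi1) = (phi1 ⊠ H) ⊙ (H ⊠ cM) ⊙ (c ⊠ M).
  by rewrite sym_nat sym_tens_r; planar.
transitivity ((phi2 ⊠ H) ⊙ (H ⊠ (cM ⊙ (H ⊠ phi1))) ⊙ (δ ⊠ H ⊠ M)); first planar.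
rewrite sym_phi1.
transitivity (((phi2 ⊙ (H ⊠ phi1)) ⊠ H) ⊙ (H ⊠ H ⊠ cM) ⊙ (H ⊠ c ⊠ M) ⊙
  (δ ⊠ H ⊠ M)); first planar.
rewrite brace_act.
transitivity ((phi1 ⊠ H) ⊙ (μ ⊠ Γ ⊠ H) ⊙ (H ⊠ c ⊠ cM) ⊙ (H ⊠ H ⊠ c ⊠ M) ⊙
  (((δ ⊠ H) ⊙ δ) ⊠ H ⊠ M)); first planar.
rewrite delta_coassoc.
transitivity ((phi1 ⊠ H) ⊙ (μ ⊠ Γ ⊠ H) ⊙ (H ⊠ H ⊠ H ⊠ cM) ⊙
  (H ⊠ ((c ⊠ H) ⊙ (H ⊠ c) ⊙ (δ ⊠ H)) ⊠ M) ⊙ (δ ⊠ H ⊠ M)); first planar.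
(* The crossings of g with h_2 and with h_3 merge into a single crossing made before the
   coproduct. *)
by rewrite -delta_sym_r; planar.
Qed.

Lemma twist_unit (X : H ⊗ M ~> M ⊗ H) :
  twist X ⊙ (H ⊠ η ⊠ M) = (phi1 ⊠ H) ⊙ (H ⊠ X) ⊙ (δ ⊠ M).
Proof.
have sym_eta : c ⊙ (H ⊠ η) = η ⊠ H by rewrite sym_nat sym_unit_r; planar.
transitivity ((phi1 ⊠ H) ⊙ (μ ⊠ X) ⊙ (H ⊠ (c ⊙ (H ⊠ η)) ⊠ M) ⊙ (δ ⊠ M));
  first planar.
rewrite sym_eta.
transitivity ((phi1 ⊠ H) ⊙ ((μ ⊙ (H ⊠ η)) ⊠ X) ⊙ (δ ⊠ M)); first planar.
by rewrite mul_unit_r.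
Qed.

Lemma twist_inj (X Y : H ⊗ M ~> M ⊗ H) :
  twist X = twist Y -> X = Y :> arrow C.
Proof.
move=> /(congr1 (fun f => f ⊙ (H ⊠ η ⊠ M))); rewrite !twist_unit => e.
apply: (convolution_inj phi1P (D := H) (N := M) (K := H)
  (d := δ) (e := ε) (p := H)) => //.
- exact: delta_coassoc.
- exact: delta_counit_l.
- by planar.
- by planar.
Qed.

End BraceModule.

Theorem theorem4p2 (C : strict_symmetric_monoidal) (H : hopf_brace C) (M : C)
    (phi1 phi2 : H ⊗ M ~> M) (hM : is_brace_module H phi1 phi2) :
  is_Z_module H phi1 phi2 <->
  cocommutativity_class (brace2 H) (Gamma (brace1 H) phi1 phi2).
Proof.
split=> [[_ _ hZ]|[_ hcc]]; split.
- exact: Gamma_module.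
- apply: Arrow_inj; apply: (twist_inj hM).
  (* The right side of the Z-module equation is [twist W] and its left side is [twist V] by
     [Z_module_lhs]. *)
  move/(congr1 (@Arrow C _ _)): hZ; rewrite !arrowE -!GammaE => <-.
  by rewrite (Z_module_lhs hM).
- exact: brace_module1 hM.
- exact: brace_module2 hM.
apply: Arrow_inj; rewrite !arrowE -!GammaE (Z_module_lhs hM).
(* Cocommutativity replaces V by W inside [twist V]. *)
by move/(congr1 (@Arrow C _ _)): hcc; rewrite !arrowE -!GammaE => ->.
Qed.
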